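(* Let $n\ge1$ and $t,u\in\mathbb{C}^\times$. The odd Euler operator $E$, the operator $r^2$ and the operator $\Delta$ on the skew polynomial ring $P^-$ satisfy $$[E,r^2]=2r^2,\qquad [E,\Delta]=-2\Delta,$$ where $[p,q]=pq-qp$.
   Context: $P^-=\mathbb{C}\langle x_1,\dots,x_n\rangle/\langle x_ix_j+x_jx_i : i\ne j\rangle$ is the skew polynomial ring, graded with $\deg x_i=1$; $|f|$ is the degree of a homogeneous $f$, and formulas involving $|f|$ are extended linearly. Ring elements inside operator expressions denote left multiplication. For $i\ne k$, $s_{i,k}$ is the algebra automorphism exchanging $x_i$ and $x_k$ and fixing the other variables; $\partial_{i,k}(f)=(x_k^2-x_i^2)^{-1}[(x_k-x_i)f-(-1)^{|f|}s_{i,k}(f)(x_k-x_i)]$ (computed in the localization at the central element $x_k^2-x_i^2$, with values in $P^-$); $r_{i,k}=\partial_{i,k}s_{i,k}$. The $\mathbb{C}$-linear operator $p_i:P^-\to P^-$ is given by $$p_i(x_1^{\lambda_1}\cdots x_n^{\lambda_n})=\lambda_i(-1)^{\lambda_1+\dots+\lambda_{i-1}}x_1^{\lambda_1}\cdots x_i^{\lambda_i-1}\cdots x_n^{\lambda_n}.$$ Set $D_i=tp_i+u\sum_{k\ne i}r_{i,k}$ (sum over $k\in\{1,\dots,n\}\setminus\{i\}$), and $$r^2=(2t)^{-1}\sum_{i=1}^n x_i^2,\qquad E=\sum_{i=1}^n x_ip_i+\frac n2+\frac ut\sum_{1\le i<k\le n}s_{i,k},\qquad \Delta=-(2t)^{-1}\sum_{i=1}^n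 D_i^2 .$$ *)

(* Defs.v *)
From HB Require Import structures.
From mathcomp Require Import all_boot all_order perm all_algebra.
From mathcomp Require Import boolp reals.
From mathcomp Require Import complex.
From mathcomp Require Import monalg.

Set Implicit Arguments.
Unset Strict Implicit.
Unset Printing Implicit Defensive.

Import GRing.Theory.

Local Open Scope ring_scope.
Local Open Scope quotient_scope.

Section SkewPolynomialRing.
Context (F : fieldType) (n : nat).

Local Notation freealg := {malg F[{fmonom 'I_n}]}.

(* [{fmonom 'I_n}] is the free monoid on n letters, so [freealg] is the free
   algebra F<x_1, ..., x_n>; indices run from 0 to n - 1. *)
Definition freevar (i : 'I_n) : freealg := << fmu i >>.

Inductive skew_ideal : freealg -> Prop :=
| skew_ideal_gen i j of i != j :
    skew_ideal (freevar i * freevar j + freevar j * freevar i)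
| skew_ideal0 : skew_ideal 0
| skew_idealD f g of skew_ideal f & skew_ideal g : skew_ideal (f + g)
| skew_idealMl a f of skew_ideal f : skew_ideal (a * f)
| skew_idealMr a f of skew_ideal f : skew_ideal (f * a).

Lemma skew_idealN f : skew_ideal f -> skew_ideal (- f).
Proof. by move=> If; rewrite -mulN1r; apply: skew_idealMl. Qed.

Definition skew_eqv (f g : freealg) : bool := `[< skew_ideal (f - g) >].

Lemma skew_eqv_refl : reflexive skew_eqv.
Proof. by move=> f; apply/asboolP; rewrite subrr; apply: skew_ideal0. Qed.

Lemma skew_eqv_sym : symmetric skew_eqv.
Proof.
move=> f g; apply/asboolP/asboolP => /skew_idealN; by rewrite opprB.
Qed.

Lemma skew_eqv_trans : transitive skew_eqv.
Proof.
move=> g f h /asboolP Ifg /asboolP Igh; apply/asboolP.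
by rewrite -(subrKA g); apply: skew_idealD.
Qed.

Canonical skew_eqv_rel :=
  EquivRel skew_eqv skew_eqv_refl skew_eqv_sym skew_eqv_trans.

Definition skewpoly := {eq_quot skew_eqv_rel}.
HB.instance Definition _ := Choice.on skewpoly.
HB.instance Definition _ := EqQuotient.on skewpoly.

Definition skpi (f : freealg) : skewpoly := \pi_skewpoly f.

Lemma skew_piP (f g : freealg) :
  reflect (skpi f = skpi g) `[< skew_ideal (f - g) >].
Proof. exact: (@eqquotP _ skew_eqv_rel skewpoly f g). Qed.

Lemma skew_pi_eq (f g : freealg) :
  skew_ideal (f - g) -> skpi f = skpi g.
Proof. by move=> ?; apply/skew_piP/asboolP. Qed.

Lemma skew_repr (f : freealg) : skew_ideal (repr (skpi f) - f).
Proof. by apply/asboolP/skew_piP; apply: reprK. Qed.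

Lemma skewW (P : skewpoly -> Type) : (forall f, P (skpi f)) -> forall f, P f.
Proof. exact: quotW. Qed.

Definition sk0 : skewpoly := skpi 0.
Definition sk1 : skewpoly := skpi 1.
(* The operations are locked only to keep unification from unfolding them. *)
Fact skewpoly_key : unit. Proof. by []. Qed.
Definition skopp : skewpoly -> skewpoly :=
  locked_with skewpoly_key (fun f => skpi (- repr f)).
Definition skadd : skewpoly -> skewpoly -> skewpoly :=
  locked_with skewpoly_key (fun f g => skpi (repr f + repr g)).
Definition skmul : skewpoly -> skewpoly -> skewpoly :=
  locked_with skewpoly_key (fun f g => skpi (repr f * repr g)).
Definition skscale : F -> skewpoly -> skewpoly :=
  locked_with skewpoly_key (fun c f => skpi (c *: repr f)).

Lemma sk_piN f : skopp (skpi f) = skpi (- f).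
Proof.
rewrite /skopp unlock; apply: skew_pi_eq; rewrite -opprD; apply: skew_idealN.
exact: skew_repr.
Qed.

Lemma sk_piD f g : skadd (skpi f) (skpi g) = skpi (f + g).
Proof.
rewrite /skadd unlock; apply: skew_pi_eq; rewrite opprD addrACA.
by apply: skew_idealD; apply: skew_repr.
Qed.

Lemma sk_piM f g : skmul (skpi f) (skpi g) = skpi (f * g).
Proof.
rewrite /skmul unlock; apply: skew_pi_eq; set f' := repr _; set g' := repr _.
have -> : f' * g' - f * g = (f' - f) * g' + f * (g' - g).
  by rewrite mulrBl mulrBr addrA subrK.
apply: skew_idealD; [apply: skew_idealMr|apply: skew_idealMl]; exact: skew_repr.
Qed.

Lemma sk_piZ c f : skscale c (skpi f) = skpi (c *: f).
Proof.
rewrite /skscale unlock; apply: skew_pi_eq; rewrite -scalerBr -mulr_algl; apply: skew_idealMl.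
exact: skew_repr.
Qed.

Lemma skaddA : associative skadd.
Proof.
by elim/skewW=> f; elim/skewW=> g; elim/skewW=> h; rewrite !sk_piD addrA.
Qed.
Lemma skaddC : commutative skadd.
Proof. by elim/skewW=> f; elim/skewW=> g; rewrite !sk_piD addrC. Qed.
Lemma skadd0 : left_id sk0 skadd.
Proof. by elim/skewW=> f; rewrite sk_piD add0r. Qed.
Lemma skaddN : left_inverse sk0 skopp skadd.
Proof. by elim/skewW=> f; rewrite sk_piN sk_piD addNr. Qed.
HB.instance Definition _ := GRing.isZmodule.Build skewpoly skaddA skaddC skadd0 skaddN.

Lemma skmulA : associative skmul.
Proof.
by elim/skewW=> f; elim/skewW=> g; elim/skewW=> h; rewrite !sk_piM mulrA.
Qed.
Lemma skmul1 : left_id sk1 skmul.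
Proof. by elim/skewW=> f; rewrite sk_piM mul1r. Qed.
Lemma skmulr1 : right_id sk1 skmul.
Proof. by elim/skewW=> f; rewrite sk_piM mulr1. Qed.
Lemma skmulDl : left_distributive skmul skadd.
Proof.
elim/skewW=> f; elim/skewW=> g; elim/skewW=> h.
by rewrite !(sk_piD, sk_piM) mulrDl.
Qed.
Lemma skmulDr : right_distributive skmul skadd.
Proof.
elim/skewW=> f; elim/skewW=> g; elim/skewW=> h.
by rewrite !(sk_piD, sk_piM) mulrDr.
Qed.

Section FreeLift.
Context (A : nzRingType) (a : {rmorphism F -> A}) (y : 'I_n -> A).
Hypothesis ay : forall c i, GRing.comm (a c) (y i).

Definition monlift (m : {fmonom 'I_n}) : A := \prod_(i <- m : seq 'I_n) y i.

Lemma monlift_mmorphism : mmorphism monlift.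
Proof.
split; last by rewrite /monlift fm1 big_nil.
by move=> m1 m2; rewrite /monlift fmM big_cat.
Qed.
HB.instance Definition _ :=
  isMultiplicative.Build {fmonom 'I_n} A monlift monlift_mmorphism.

Definition freelift (f : freealg) : A := mmap a monlift f.

Lemma freeliftB : {morph freelift : f g / f - g}.
Proof. exact: mmapB. Qed.
Lemma freeliftD : {morph freelift : f g / f + g}.
Proof. exact: mmapD. Qed.

Lemma freelift_mul : multiplicative freelift.
Proof.
apply: commr_mmap_is_multiplicative => g m m'.
by apply: commr_prod => i _; apply: ay.
Qed.

Lemma freeliftM (f g : freealg) : freelift (f * g) = freelift f * freelift g.
Proof. exact: freelift_mul.1. Qed.

Lemma freelift1 : freelift 1 = 1.
Proof. exact: freelift_mul.2. Qed.

Lemma freelift_var i : freelift (freevar i) = y i.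
Proof. by rewrite /freelift mmapU /= rmorph1 mul1r /monlift fmuE big_seq1. Qed.

Lemma freeliftC c : freelift c%:A = a c.
Proof. by rewrite /freelift mmapZ mmap1 mulr1. Qed.

Lemma freeliftZ c f : freelift (c *: f) = a c * freelift f.
Proof. exact: mmapZ. Qed.

Lemma freelift0 : freelift 0 = 0.
Proof. exact: mmap0. Qed.

Local Opaque freelift.

Hypothesis yN : forall i j, i != j -> y i * y j + y j * y i = 0.

Lemma freelift_ideal f : skew_ideal f -> freelift f = 0.
Proof.
elim=> [i j /yN||g h _ Ig _ Ih|g h _ Ih|g h _ Ih].
- move=> <-; move: (freelift_var i) (freelift_var j).
  move: (freevar i) (freevar j) => g h.
  rewrite freeliftD => <- <-.
  by congr (_ + _); [exact: freeliftM g h|exact: freeliftM h g].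
- exact: freelift0.
- by rewrite freeliftD Ig Ih addr0.
- by rewrite freeliftM Ih mulr0.
- by rewrite freeliftM Ih mul0r.
Qed.
End FreeLift.

Lemma sk1_neq0 : sk1 != sk0.
Proof.
apply/eqP => /skew_piP/asboolP; rewrite subr0 => I1.
have c0 (c : F) (i : 'I_n) : GRing.comm (idfun c) ((fun=> 0) i : F).
  exact: commr0.
have z0 (i j : 'I_n) : i != j -> (fun=> 0 : F) i * 0 + 0 * 0 = 0 :> F.
  by rewrite !mulr0 addr0.
have := @freelift_ideal F idfun (fun=> 0) c0 z0 1 I1.
by rewrite (freelift1 c0) => /eqP; rewrite oner_eq0.
Qed.

HB.instance Definition _ := GRing.Zmodule_isNzRing.Build skewpoly
  skmulA skmul1 skmulr1 skmulDl skmulDr sk1_neq0.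

Lemma skpiD f g : skpi (f + g) = skpi f + skpi g.
Proof. by rewrite -sk_piD. Qed.
Lemma skpiN f : skpi (- f) = - skpi f.
Proof. by rewrite -sk_piN. Qed.
Lemma skpiM f g : skpi (f * g) = skpi f * skpi g.
Proof. by rewrite -sk_piM. Qed.
Lemma skpi1 : skpi 1 = 1. Proof. by []. Qed.

Lemma skscaleA a b f : skscale a (skscale b f) = skscale (a * b) f.
Proof. by elim/skewW: f => f; rewrite !sk_piZ scalerA. Qed.
Lemma skscale1 : left_id 1 skscale.
Proof. by elim/skewW => f; rewrite sk_piZ scale1r. Qed.
Lemma skscaleDr : right_distributive skscale +%R.
Proof.
move=> c; elim/skewW => f; elim/skewW => g.
by rewrite -skpiD !sk_piZ -skpiD scalerDr.
Qed.
Lemma skscaleDl f : {morph skscale^~ f : a b / a + b}.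
Proof.
by move=> a b; elim/skewW: f => f; rewrite !sk_piZ -skpiD scalerDl.
Qed.
HB.instance Definition _ := GRing.Zmodule_isLmodule.Build F skewpoly
  skscaleA skscale1 skscaleDr skscaleDl.

Lemma skpiZ c f : skpi (c *: f) = c *: skpi f.
Proof. by rewrite -sk_piZ. Qed.

Lemma skscaleAl (c : F) (f g : skewpoly) : c *: (f * g) = c *: f * g.
Proof.
elim/skewW: f => f; elim/skewW: g => g.
rewrite -[in RHS]skpiZ -[in LHS]skpiM -skpiZ -skpiM; congr skpi.
exact: scalerAl.
Qed.
HB.instance Definition _ := GRing.Lmodule_isLalgebra.Build F skewpoly skscaleAl.

Lemma free_scaleAr (c : F) (f g : freealg) : c *: (f * g) = f * (c *: g).
Proof.
have fc : f * c%:MP = c%:MP * f.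
  rewrite !malgM_def fgmulUg fgmulgU; apply: eq_bigr => m _.
  by rewrite mulrC mulm1 mul1m.
apply: etrans (esym (mul_malgC c (f * g))) _.
apply: etrans (mulrA _ _ _) _.
apply: etrans (congr1 ( *%R^~ g) (esym fc)) _.
exact: etrans (esym (mulrA _ _ _)) (congr1 ( *%R f) (mul_malgC c g)).
Qed.

Lemma skscaleAr (c : F) (f g : skewpoly) : c *: (f * g) = f * (c *: g).
Proof.
elim/skewW: f => f; elim/skewW: g => g.
rewrite -[in RHS]skpiZ -[in LHS]skpiM -skpiZ -skpiM; congr skpi.
exact: free_scaleAr.
Qed.
HB.instance Definition _ := GRing.Lalgebra_isAlgebra.Build F skewpoly skscaleAr.

Definition skX : 'I_n -> skewpoly :=
  locked_with skewpoly_key (fun i => skpi (freevar i)).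

Lemma skXE i : skX i = skpi (freevar i).
Proof. by rewrite /skX unlock. Qed.

Lemma skX_anticomm i j : i != j -> skX i * skX j = - (skX j * skX i).
Proof.
move=> ij; rewrite !skXE -!skpiM -skpiN.
by apply: skew_pi_eq; rewrite opprK; apply: skew_ideal_gen.
Qed.

Lemma skpi_is_linear : linear skpi.
Proof.
by move=> c f g; rewrite skpiD skpiZ.
Qed.

Lemma freemonE (s : seq 'I_n) :
  << FMonom s >> = \prod_(i <- s) freevar i :> freealg.
Proof.
elim: s => [|i s IH]; first by rewrite big_nil /GRing.one /= /fgone -fmE.
rewrite big_cons -IH malgM_def fgmulUU mulr1; congr << _ >>.
by apply/val_inj; rewrite /= fmM fmU.
Qed.

Lemma skew_ind (P : skewpoly -> Prop) :
  P 1 -> (forall c f g, P f -> P g -> P (c *: f + g)) ->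
  (forall i f, P f -> P (skX i * f)) -> forall f, P f.
Proof.
move=> P1 Plin PX.
have P0 : P 0 by rewrite -[0](addNr 1) -scaleN1r; apply: Plin.
have PZ c f : P f -> P (c *: f) by move=> Pf; rewrite -[_ *: _]addr0; apply: Plin.
elim/skewW => f; rewrite [f]monalgE; elim/big_ind: _ => //.
- move=> g h Pg Ph; have := Plin 1 _ _ Pg Ph; congr P.
  by rewrite -skpi_is_linear scale1r.
- move=> [s] _; move: (f@__) => c.
  have -> : << c *g FMonom s >> = c *: \prod_(i <- s) freevar i + 0.
    by rewrite addr0 -freemonE -mul_malgC malgM_def fgmulUU mul1m mulr1.
  rewrite skpi_is_linear addr0; apply: PZ.
  elim: s => [|i s IH]; first by rewrite big_nil.
  by rewrite big_cons skpiM -skXE; apply: PX.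
Qed.

Section SkewLift.
Context (A : nzRingType) (a : {rmorphism F -> A}) (y : 'I_n -> A).
Hypothesis ay : forall c i, GRing.comm (a c) (y i).
Hypothesis yN : forall i j, i != j -> y i * y j + y j * y i = 0.

(* Universal property: [sklift] is the ring morphism extending a : F -> A and
   sending x_i to y i, for anticommuting y i that commute with the scalars. *)
Definition sklift (f : skewpoly) : A := freelift a y (repr f).

Lemma sklift_pi f : sklift (skpi f) = freelift a y f.
Proof.
apply/eqP; rewrite -subr_eq0 -freeliftB; apply/eqP.
by apply: freelift_ideal => //; apply: skew_repr.
Qed.

Lemma skliftX i : sklift (skX i) = y i.
Proof. by rewrite skXE sklift_pi freelift_var. Qed.

Lemma skliftP c f g : sklift (c *: f + g) = a c * sklift f + sklift g.
Proof.
elim/skewW: f => f; elim/skewW: g => g.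
by rewrite -skpi_is_linear !sklift_pi freeliftD freeliftZ.
Qed.

Lemma sklift1 : sklift 1 = 1.
Proof. by rewrite sklift_pi (freelift1 ay). Qed.

Lemma skliftM f g : sklift (f * g) = sklift f * sklift g.
Proof.
elim/skewW: f => f; elim/skewW: g => g.
by rewrite -skpiM !sklift_pi (freeliftM ay).
Qed.
End SkewLift.

Definition skmonom (lam : 'I_n -> nat) : skewpoly := \prod_(j < n) skX j ^+ lam j.

Lemma in_alg_comm (y : 'I_n -> skewpoly) (c : F) (i : 'I_n) : GRing.comm (in_alg skewpoly c) (y i).
Proof. by rewrite /GRing.comm /= mulr_algl mulr_algr. Qed.

(* f |-> (-1)^|f| f for homogeneous f, extended linearly (the two agree by
   [skparity_prod]): it is the algebra morphism x_j |-> - x_j. *)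
Definition skparity : skewpoly -> skewpoly :=
  sklift (in_alg skewpoly) (fun j => - skX j).

Definition skswap (i k : 'I_n) : skewpoly -> skewpoly :=
  sklift (in_alg skewpoly) (fun j => skX (tperm i k j)).

Lemma skX_anticomm0 i j : i != j -> skX i * skX j + skX j * skX i = 0.
Proof. by move=> /skX_anticomm ->; rewrite addNr. Qed.

Lemma skparity_rel i j : i != j -> - skX i * - skX j + - skX j * - skX i = 0.
Proof. by rewrite !mulrNN; apply: skX_anticomm0. Qed.

Lemma skswap_rel a b i j : i != j ->
  skX (tperm a b i) * skX (tperm a b j) + skX (tperm a b j) * skX (tperm a b i) = 0.
Proof. by move=> ij; apply: skX_anticomm0; rewrite (inj_eq perm_inj). Qed.

Lemma skparityX j : skparity (skX j) = - skX j.
Proof. exact: (skliftX (in_alg_comm _) skparity_rel). Qed.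

Lemma skparity1 : skparity 1 = 1.
Proof. exact: (sklift1 (in_alg_comm _) skparity_rel). Qed.

Lemma skparityM f g : skparity (f * g) = skparity f * skparity g.
Proof. exact: (skliftM (in_alg_comm _) skparity_rel). Qed.

Lemma skparityP c f g : skparity (c *: f + g) = c *: skparity f + skparity g.
Proof.
by rewrite /skparity (skliftP (in_alg_comm _) skparity_rel) /= mulr_algl.
Qed.

Lemma skparity_prod (s : seq 'I_n) :
  skparity (\prod_(j <- s) skX j) = (-1) ^+ size s *: \prod_(j <- s) skX j.
Proof.
elim: s => [|j s IH]; first by rewrite !big_nil skparity1 scale1r.
by rewrite !big_cons skparityM skparityX IH mulNr -scalerAr exprS -scalerA scaleN1r.
Qed.

Lemma skswapX i k j : skswap i k (skX j) = skX (tperm i k j).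
Proof. exact: (skliftX (in_alg_comm _) (@skswap_rel i k)). Qed.

Lemma skswap1 i k : skswap i k 1 = 1.
Proof. exact: (sklift1 (in_alg_comm _) (@skswap_rel i k)). Qed.

Lemma skswapM i k f g : skswap i k (f * g) = skswap i k f * skswap i k g.
Proof. exact: (skliftM (in_alg_comm _) (@skswap_rel i k)). Qed.

Lemma skswapP i k c f g : skswap i k (c *: f + g) = c *: skswap i k f + skswap i k g.
Proof.
by rewrite /skswap (skliftP (in_alg_comm _) (@skswap_rel i k)) /= mulr_algl.
Qed.

Lemma skXsq_central i f : skX i ^+ 2 * f = f * skX i ^+ 2.
Proof.
elim/skew_ind: f => [|c f g Hf Hg|j f Hf]; first by rewrite mul1r mulr1.
  by rewrite mulrDr mulrDl -scalerAr Hf scalerAl Hg.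
rewrite -mulrA -Hf !mulrA; congr (_ * _).
have [->|ij] := eqVneq i j; first by rewrite expr2.
by rewrite expr2 -mulrA (skX_anticomm ij) mulrN mulrA (skX_anticomm ij) mulNr opprK.
Qed.

Lemma skdivdiff_exists i k f : exists g,
  (skX k ^+ 2 - skX i ^+ 2) * g =
    (skX k - skX i) * f - skswap i k (skparity f) * (skX k - skX i).
Proof.
set Z := skX k ^+ 2 - _; set X := _ - skX i.
have ZC g : Z * g = g * Z by rewrite mulrBl mulrBr (skXsq_central k g) (skXsq_central i g).
elim/skew_ind: f => [|c f f' [g Hg] [g' Hg']|j f [g Hg]].
- by exists 0; rewrite skparity1 skswap1 mul1r mulr1 subrr mulr0.
- exists (c *: g + g'); rewrite skparityP skswapP (mulrDr Z) (mulrDr X) [(c *: _ + _) * X]mulrDl opprD addrACA.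
  by rewrite -!scalerAr -scalerAl -scalerBr Hg Hg'.
suff [h Hh] : exists h, Z * h = X * skX j + skX (tperm i k j) * X.
  clearbody X Z; exists (h * f - skX (tperm i k j) * g).
  rewrite skparityM skswapM skparityX.
  have -> : skswap i k (- skX j) = - skX (tperm i k j).
    have := skswapP i k (-1) (skX j) 0; rewrite addr0 scaleN1r => ->.
    rewrite skswapX scaleN1r; have := skswapP i k (-1) 0 0.
    by rewrite scaler0 addr0 => ->; rewrite scaleN1r addNr addr0.
  set y := skX (tperm i k j) in Hh *; set f' := skswap i k _ in Hg *.
  have -> : Z * (h * f - y * g) = Z * h * f - y * (Z * g).
    by rewrite (mulrBr Z) !mulrA (ZC y).
  rewrite Hh Hg (mulrDl (X * _)) mulrBr !mulrA !mulNr opprK opprB.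
  by rewrite [y * f' * X - _]addrC addrA addrK.
have [->|ji] := eqVneq j i.
  exists 1; rewrite tpermL mulr1 /X mulrBl mulrBr -!expr2.
  by rewrite addrC addrA subrK.
have [->|jk] := eqVneq j k.
  exists 1; rewrite tpermR mulr1 /X mulrBl mulrBr -!expr2.
  by rewrite addrA subrK.
exists 0; rewrite tpermD 1?eq_sym // mulr0 /X mulrBl mulrBr.
by rewrite (skX_anticomm jk) (skX_anticomm ji) opprK addrACA subrr addNr addr0.
Qed.

(* The quotient by x_k^2 - x_i^2 taken in the localization lies in the ring, by
   [skdivdiff_exists]. It is the only solution of the equation defining it,
   x_k^2 - x_i^2 being central ([skXsq_central]) and regular for i != k; the
   case i = k is never used. *)
Definition skdivdiff (i k : 'I_n) (f : skewpoly) : skewpoly :=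
  sval (cid (skdivdiff_exists i k f)).


(* [low i] is the upper right entry of the ring morphism to 2 x 2 matrices
   sending x_i to [x_i, 1; 0, x_i] and x_j to [- x_j, 0; 0, x_j] for j != i. *)
Section LoweringExists.
Variable i : 'I_n.

Definition lowdiag (j : 'I_n) : skewpoly := if j == i then skX j else - skX j.

Definition lowmx (j : 'I_n) : 'M[skewpoly]_(1 + 1) :=
  block_mx (lowdiag j)%:M (j == i)%:R%:M 0 (skX j)%:M.

Definition lowscal : F -> 'M[skewpoly]_(1 + 1) := scalar_mx \o in_alg skewpoly.
HB.instance Definition _ := GRing.RMorphism.on lowscal.

Lemma lowscalE c : lowscal c = block_mx (c%:A)%:M 0 0 (c%:A)%:M.
Proof. by rewrite /lowscal /= scalar_mx_block. Qed.

Lemma lowmx_comm c j : GRing.comm (lowscal c) (lowmx j).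
Proof.
have cA (f : skewpoly) : c%:A * f = f * c%:A by rewrite mulr_algl mulr_algr.
rewrite /GRing.comm lowscalE /lowmx -!mulmxE !mulmx_block.
by rewrite !(mul0mx, mulmx0, addr0, add0r) -!scalar_mxM !cA.
Qed.

Lemma lowdiag_rel j k : j != k ->
  lowdiag j * lowdiag k + lowdiag k * lowdiag j = 0.
Proof.
move=> /skX_anticomm0 jk; rewrite /lowdiag.
by do 2!case: ifP => _; rewrite ?(mulNr, mulrN, opprK) -?opprD jk ?oppr0.
Qed.

Lemma lowoff_rel j k : j != k ->
  lowdiag j * (k == i)%:R + (j == i)%:R * skX k
    + (lowdiag k * (j == i)%:R + (k == i)%:R * skX j) = 0.
Proof.
rewrite /lowdiag; case: (eqVneq j i) => [->|_] => [|_]; last first.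
  by case: (k == i); rewrite !(mulr0, mul0r, mulr1, mul1r, addr0, add0r) // addNr.
rewrite eq_sym => /negbTE ->.
by rewrite !(mulr0, mul0r, mulr1, mul1r, addr0, add0r) subrr.
Qed.

Lemma lowmx_rel j k : j != k -> lowmx j * lowmx k + lowmx k * lowmx j = 0.
Proof.
move=> jk; rewrite /lowmx -!mulmxE !mulmx_block.
rewrite !(mul0mx, mulmx0, addr0, add0r) -!scalar_mxM -!raddfD.
rewrite add_block_mx -!raddfD /= lowdiag_rel // lowoff_rel // skX_anticomm0 //.
by rewrite !raddf0 addr0 block_mx0.
Qed.

Definition lowlift (f : skewpoly) : 'M[skewpoly]_(1 + 1) := sklift lowscal lowmx f.

Lemma lowlift1 : lowlift 1 = block_mx 1%:M 0 0 1%:M.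
Proof.
by rewrite -scalar_mx_block; apply: (sklift1 lowmx_comm lowmx_rel).
Qed.

Lemma lowliftP c f g : lowlift (c *: f + g) =
  block_mx (c%:A)%:M 0 0 (c%:A)%:M *m lowlift f + lowlift g.
Proof. by rewrite -lowscalE; apply: (skliftP lowmx_comm lowmx_rel). Qed.

Lemma lowliftXM j f : lowlift (skX j * f) = lowmx j *m lowlift f.
Proof.
by rewrite -(skliftX lowmx_comm lowmx_rel j); apply: (skliftM lowmx_comm lowmx_rel).
Qed.

Definition low (f : skewpoly) : skewpoly := ursubmx (lowlift f) 0 0.

Lemma lowmx_corner f : drsubmx (lowlift f) = f%:M.
Proof.
elim/skew_ind: f => [|c f g Hf Hg|j f Hf].
- by rewrite lowlift1 block_mxKdr.
- rewrite lowliftP -[X in _ *m X]submxK mulmx_block -[X in _ + X]submxK.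
  rewrite add_block_mx block_mxKdr Hf Hg mul0mx add0r -scalar_mxM -raddfD.
  by rewrite /= mulr_algl.
- rewrite lowliftXM -[X in _ *m X]submxK mulmx_block block_mxKdr Hf.
  by rewrite mul0mx add0r -scalar_mxM.
Qed.

Lemma low1 : low 1 = 0.
Proof. by rewrite /low lowlift1 block_mxKur mxE. Qed.

Lemma low_linear : linear low.
Proof.
move=> c f g; rewrite /low lowliftP.
rewrite -[X in _ *m X]submxK mulmx_block -[X in ursubmx (_ + X)]submxK.
rewrite add_block_mx !block_mxKur mul0mx addr0 mul_scalar_mx.
by rewrite mxE [X in X + _ = _]mxE mulr_algl.
Qed.

Lemma lowXM j f : low (skX j * f) = lowdiag j * low f + (j == i)%:R * f.
Proof.
rewrite /low lowliftXM -[X in _ *m X]submxK mulmx_block block_mxKur lowmx_corner.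
by rewrite -scalar_mxM mul_scalar_mx mxE [X in X + _ = _]mxE [X in _ + X = _]mxE mulr1n.
Qed.

Lemma lowXnM j m f : j != i -> low (skX j ^+ m * f) = (-1) ^+ m *: (skX j ^+ m * low f).
Proof.
move=> ji; elim: m => [|m IH]; first by rewrite !expr0 !mul1r scale1r.
rewrite !exprS -!mulrA lowXM IH /lowdiag (negbTE ji) mul0r addr0.
by rewrite mulN1r scaleNr mulNr -scalerAr.
Qed.

Lemma lowXin m f :
  low (skX i ^+ m * f) = m%:R *: (skX i ^+ m.-1 * f) + skX i ^+ m * low f.
Proof.
elim: m => [|m IH]; first by rewrite !expr0 !mul1r scale0r add0r.
rewrite exprS -!mulrA lowXM IH /lowdiag eqxx mul1r mulrDr -scalerAr.
rewrite addrAC; congr (_ + _); case: m {IH} => [|m].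
  by rewrite !scale0r expr0 !mul1r add0r scale1r.
by rewrite /= mulrA -exprS [m.+2%:R]mulrSr scalerDl scale1r.
Qed.

Lemma low_prod (lam : 'I_n -> nat) (s : seq 'I_n) f : i \notin s ->
  low ((\prod_(j <- s) skX j ^+ lam j) * f) =
    (-1) ^+ (\sum_(j <- s) lam j) *: ((\prod_(j <- s) skX j ^+ lam j) * low f).
Proof.
elim: s => [|j s IH]; first by rewrite !big_nil !mul1r scale1r.
rewrite inE negb_or eq_sym => /andP[ji /IH {}IH].
rewrite !big_cons -!mulrA lowXnM // IH.
by rewrite -scalerAr scalerA -exprD.
Qed.

Lemma low_monom (lam : 'I_n -> nat) :
  low (skmonom lam) =
    ((lam i)%:R * (-1) ^+ (\sum_(j < n | (j < i)%N) lam j)) *: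
      skmonom (fun j => if j == i then (lam j).-1 else lam j).
Proof.
rewrite /skmonom; have := mem_index_enum i; have := index_enum_uniq 'I_n.
have : sorted (fun a b : 'I_n => (a < b)%N) (index_enum 'I_n).
  have := iota_ltn_sorted 0 n; rewrite -val_enum_ord sorted_map enumT.
  by rewrite /index_enum !unlock.
rewrite sorted_pairwise; last by move=> a b c; apply: ltn_trans.
move=> srt uq si; case/splitPr: si srt uq => s1 s2.
rewrite pairwise_cat pairwise_cons cat_uniq /= => /and3P[/allrelP lt12 _ /andP[/allP lt2 _]].
move=> /and3P[_ dis /andP[i2 _]].
have i1 : i \notin s1 by move: dis; apply: contra => is1; rewrite is1.
rewrite !big_cat !big_cons /= ltnn eqxx.
have -> : (\sum_(j <- s1 | (j < i)%N) lam j = \sum_(j <- s1) lam j)%N.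
  rewrite [RHS]big_seq [LHS]big_seq_cond; apply: eq_bigl => j.
  by have [js|] //= := boolP (j \in s1); rewrite lt12 ?mem_head.
have -> : (\sum_(j <- s2 | (j < i)%N) lam j = 0)%N.
  rewrite big_seq_cond big_pred0 // => j.
  by have [/lt2 /= ij|] //= := boolP (j \in s2); rewrite ltnNge ltnW.
rewrite addn0.
have E (s : seq 'I_n) : i \notin s ->
    \prod_(j <- s) skX j ^+ (if j == i then (lam j).-1 else lam j)
      = \prod_(j <- s) skX j ^+ lam j.
  move=> is_; apply: eq_big_seq => j js; case: eqP => // ji.
  by rewrite -ji js in is_.
rewrite !E // low_prod // lowXin.
have -> : low (\prod_(j <- s2) skX j ^+ lam j) = 0.
  by rewrite -[X in low X]mulr1 low_prod // low1 mulr0 scaler0.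
by rewrite mulr0 addr0 -scalerAr scalerA mulrC.
Qed.

End LoweringExists.

Lemma sklower_exists i : exists p : {linear skewpoly -> skewpoly},
  forall lam : 'I_n -> nat,
    p (skmonom lam) =
      ((lam i)%:R * (-1) ^+ (\sum_(j < n | (j < i)%N) lam j)) *:
        skmonom (fun j => if j == i then (lam j).-1 else lam j).
Proof.
pose low_lin := GRing.isLinear.Build F skewpoly skewpoly *:%R (low i) (low_linear i).
pose p : {linear skewpoly -> skewpoly} := HB.pack (low i) low_lin.
by exists p; apply: low_monom.
Qed.

(* Determined by its values, as the ordered monomials span the ring. *)
Definition sklower (i : 'I_n) : {linear skewpoly -> skewpoly} :=
  sval (cid (sklower_exists i)).

Definition skr (i k : 'I_n) (f : skewpoly) : skewpoly :=
  skdivdiff i k (skswap i k f).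

Definition dunkl (t u : F) (i : 'I_n) (f : skewpoly) : skewpoly :=
  t *: sklower i f + u *: \sum_(k < n | k != i) skr i k f.

Definition rsq (t : F) (f : skewpoly) : skewpoly :=
  (2 * t)^-1 *: ((\sum_(i < n) skX i ^+ 2) * f).

Definition euler (t u : F) (f : skewpoly) : skewpoly :=
  \sum_(i < n) skX i * sklower i f + (n%:R / 2) *: f
    + (u / t) *: \sum_(i < n) \sum_(k < n | (i < k)%N) skswap i k f.

Definition laplace (t u : F) (f : skewpoly) : skewpoly :=
  - ((2 * t)^-1 *: \sum_(i < n) dunkl t u i (dunkl t u i f)).

End SkewPolynomialRing.

Definition opcomm (V : zmodType) (p q : V -> V) (f : V) : V := p (q f) - q (p f).

(* Main.v *)
Require Import Defs.
From HB Require Import structures.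
From mathcomp Require Import all_boot all_order perm all_algebra.
From mathcomp Require Import boolp reals complex.

Set Implicit Arguments.
Unset Strict Implicit.
Unset Printing Implicit Defensive.

Import GRing.Theory Num.Theory.

Local Open Scope ring_scope.
Local Open Scope complex_scope.

(** Write [N = \sum_i x_i p_i]. It multiplies a homogeneous element by its
degree, so [E] is [N] plus a scalar plus a multiple of the sum of all the
swaps [s_{i,k}]. An operator [L] that shifts degrees by [d], that
is [N L = L N + d L], and that commutes with every swap therefore satisfies
[E L - L E = d L] ([opcomm_euler]). Both identities are instances of this.

For [r^2] the two conditions are immediate: [\sum_i x_i^2] has degree 2 and is
symmetric. For [Delta] they follow from the corresponding facts on the Dunkl
operators: [D_i] lowers the degree by one ([skdeg_dunkl]), and conjugation by a
swap permutes the [D_i] ([skswap_dunkl]), so it preserves [\sum_i D_i^2].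

The work lies in transporting these facts to the two ingredients of [D_i].
- The operators [p_i] are given on ordered monomials. As these span the ring,
  [p_i] is the twisted derivation with [p_i (x_i f) = f + x_i p_i f] and
  [p_i (x_j f) = - x_j p_i f] for [j != i] ([sklowerXM]); inductions on the
  number of generators in a word then give everything about it.
- The divided difference is a solution [g] of
  [(x_k^2 - x_i^2) g = (x_k - x_i) f - s_{i,k} (eps f) (x_k - x_i)], with [eps]
  the parity automorphism. Linearity, equivariance and degree follow by
  checking the equation, provided the solution is unique, that is, provided
  [x_k^2 - x_i^2] is regular ([skXsqB_reg]). Instead of computing in a basis,
  regularity is obtained from [p_i]: it is locally nilpotent, and its
  commutator with multiplication by [z = x_k^2 - x_i^2] is multiplication by
  [- 2 x_i], which is itself regular because the commutator of [p_i] with [x_i]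
  is the identity. In characteristic 0 such a commutation relation forces
  [z] to be regular ([mul_inj_of_commutator]). *)

(** * Regularity from a locally nilpotent operator *)

(** The relation [p z = z p + c] gives [p z^(a+1) = z^(a+1) p + (a+1) c z^a]. If
[z^(a+1) v = 0], applying [p] and then [z] yields [z^(a+2) (p v) = 0]; as [p v]
is killed by a smaller power of [p], it vanishes by induction, for every
exponent of [z] at once. What remains is [(a+1) c z^a v = 0], whence
[z^a v = 0], and the exponent descends to 0. *)
Lemma mul_inj_of_commutator (F : fieldType) (A : algType F)
    (p : {linear A -> A}) (z c : A) :
    [pchar F] =i pred0 ->
    (forall v, p (z * v) = z * p v + c * v) -> c * z = z * c ->
    (forall v, c * v = 0 -> v = 0) -> (forall v, exists m, iter m p v = 0) ->
  forall v, z * v = 0 -> v = 0.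
Proof.
move=> /pcharf0P char0 pz cz c_inj p_nil v zv.
have pzn a w : p (z ^+ a.+1 * w) = z ^+ a.+1 * p w + a.+1%:R *: (c * (z ^+ a * w)).
  elim: a => [|a IH]; first by rewrite expr1 expr0 mul1r scale1r pz.
  rewrite [z ^+ a.+2]exprS -!(mulrA z) pz IH mulrDr -scalerAr -addrA; congr (_ + _).
  by rewrite [z * (c * _)]mulrA -cz -(mulrA c) (mulrA z (z ^+ a)) -exprS
    -[X in _ + X]scale1r -scalerDl natr1.
have [m] := p_nil v; have : z ^+ 1 * v = 0 by rewrite expr1.
elim: m v {zv} 1%N => [|m IHm] v a; first by [].
elim: a => [|a IHa] zav; first by rewrite expr0 mul1r in zav.
rewrite iterSr => pmv.
have := pzn a v; rewrite zav linear0 => /esym pzav.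
have pv : p v = 0.
  apply: (IHm _ a.+2) pmv; rewrite [z ^+ a.+2]exprS -mulrA.
  have -> : z ^+ a.+1 * p v = - (a.+1%:R *: (c * (z ^+ a * v))).
    by apply/eqP; rewrite -addr_eq0 pzav.
  by rewrite mulrN -scalerAr [z * (c * _)]mulrA -cz -(mulrA c) (mulrA z (z ^+ a))
    -exprS zav mulr0 scaler0 oppr0.
apply: IHa; last by rewrite iterSr.
apply: c_inj; move/eqP: pzav.
by rewrite pv mulr0 add0r scaler_eq0 char0 /= => /eqP.
Qed.

(** * Ordered monomials and the operators [p_i] *)

Section SkewOperators.
Context (F : fieldType) (n : nat).
Local Notation P := (skewpoly F n).
Local Notation x_ := (@skX F n).
Local Notation p := (@sklower F n).
Local Notation s := (@skswap F n).
Local Notation "\eps" := (@skparity F n).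
Local Notation skmon := (@skmonom F n).

HB.instance Definition _ :=
  GRing.isLinear.Build F P P *:%R (@skparity F n) (@skparityP F n).
HB.instance Definition _ i k :=
  GRing.isLinear.Build F P P *:%R (@skswap F n i k) (@skswapP F n i k).

Lemma skX_prod_comm (lam : 'I_n -> nat) i (r : seq 'I_n) : i \notin r ->
  exists c : F, x_ i * (\prod_(j <- r) x_ j ^+ lam j) =
    c *: ((\prod_(j <- r) x_ j ^+ lam j) * x_ i).
Proof.
elim: r => [_|j r IH].
  by exists 1; rewrite big_nil mul1r mulr1 scale1r.
rewrite inE negb_or => /andP[ij /IH[c Hc]].
have [d Hd] : exists d : F, x_ i * x_ j ^+ lam j = d *: (x_ j ^+ lam j * x_ i).
  elim: (lam j) => [|m [d Hd]].
    by exists 1; rewrite expr0 mul1r mulr1 scale1r.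
  exists (- d); rewrite exprS mulrA (skX_anticomm _ ij) mulNr -!mulrA Hd.
  by rewrite -scalerAr scaleNr.
by exists (d * c); rewrite !big_cons mulrA Hd -scalerAl -!mulrA Hc -scalerAr
  scalerA.
Qed.

Lemma skX_monom i (lam : 'I_n -> nat) : exists c : F,
  x_ i * skmon lam = c *: skmon (fun j => if j == i then (lam j).+1 else lam j).
Proof.
rewrite /skmonom; have := index_enum_uniq 'I_n.
case/splitPr: (mem_index_enum i) => r1 r2.
rewrite cat_uniq cons_uniq => /and3P[_ dis /andP[i2 _]].
have i1 : i \notin r1 by move: dis; apply: contra => i1 /=; rewrite i1.
have [c Hc] := skX_prod_comm lam i1; exists c.
rewrite !big_cat !big_cons /= eqxx mulrA Hc -scalerAl -mulrA (mulrA (x_ i)) -exprS.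
have E (r : seq 'I_n) : i \notin r ->
    \prod_(j <- r) x_ j ^+ (if j == i then (lam j).+1 else lam j)
      = \prod_(j <- r) x_ j ^+ lam j.
  move=> ir; apply: eq_big_seq => j jr; case: eqP => // ji.
  by rewrite -ji jr in ir.
by rewrite !E.
Qed.

(** The ordered monomials span: their span contains 1 and, by [skX_monom], is
stable under left multiplication by the generators. *)
Lemma skmonom_ind (Q : P -> Prop) :
  (forall lam, Q (skmon lam)) ->
  (forall c f g, Q f -> Q g -> Q (c *: f + g)) -> forall f, Q f.
Proof.
move=> Qmon Qlin.
have Q0 : Q 0 by rewrite -(addNr (skmon (fun=> 0%N))) -scaleN1r; apply: Qlin.
(* Quantifying over the predicate lets the induction on words use [Q] shifted
   by a generator. *)
suff all f : forall R : P -> Prop, (forall lam, R (skmon lam)) -> R 0 ->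
    (forall c f g, R f -> R g -> R (c *: f + g)) -> R f by move=> f; exact: all.
elim/skew_ind: f => [|c f g IHf IHg|i f IH] R Rmon R0 Rlin.
- have := Rmon (fun=> 0%N); rewrite /skmonom big1 // => j _; exact: expr0.
- by apply: (Rlin); [exact: IHf Rmon R0 Rlin|exact: IHg Rmon R0 Rlin].
apply: (IH (fun g => R (x_ i * g))).
- move=> lam; have [c ->] := skX_monom i lam.
  by rewrite -[_ *: _]addr0; apply: Rlin.
- by rewrite mulr0.
by move=> c g h Rg Rh; rewrite mulrDr -scalerAr; apply: Rlin.
Qed.

(** Connects the values on monomials with the recursion [lowXM], which is the
form in which [p_i] is used from here on. *)
Lemma sklowerE i f : p i f = low i f.
Proof.
elim/skmonom_ind: f => [lam|c f g Hf Hg].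
  by rewrite low_monom; apply: (svalP (cid (sklower_exists F i))).
by rewrite linearP low_linear Hf Hg.
Qed.

Lemma sklower1 i : p i 1 = 0.
Proof. by rewrite sklowerE low1. Qed.

Lemma sklowerXM i j f :
  p i (x_ j * f) = if j == i then f + x_ i * p i f else - (x_ j * p i f).
Proof.
rewrite !sklowerE lowXM /lowdiag; case: eqP => [->|_].
  by rewrite mul1r addrC.
by rewrite mul0r addr0 mulNr.
Qed.

(** Every application of [p_i] removes one letter [x_i] from a word and leaves
the other letters in place up to sign. *)
Lemma sklower_nilp i f : exists m, iter m (p i) f = 0.
Proof.
have iter0 m : iter m (p i) 0 = 0 by elim: m => //= m ->; rewrite linear0.
elim/skew_ind: f => [|c f g [a fa] [b gb]|j f [m fm]].
- by exists 1%N; rewrite /= sklower1.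
- have iterP k : iter k (p i) (c *: f + g) = c *: iter k (p i) f + iter k (p i) g.
    by elim: k => //= k ->; rewrite linearP.
  exists (a + b)%N; rewrite iterP [X in _ + X]iterD gb iter0 addnC iterD fa iter0.
  by rewrite scaler0 addr0.
have [->|ji] := eqVneq j i.
  exists m.+1.
  have -> k : iter k.+1 (p i) (x_ i * f) = k.+1%:R *: iter k (p i) f
      + x_ i * iter k.+1 (p i) f.
    elim: k => [|k IH]; first by rewrite /= sklowerXM eqxx scale1r.
    rewrite iterS IH linearD linearZ sklowerXM eqxx addrA.
    by rewrite -[X in _ + X + _]scale1r -scalerDl natr1.
  by rewrite iterS fm linear0 scaler0 mulr0 addr0.
exists m.
suff -> k : iter k (p i) (x_ j * f) = (-1) ^+ k *: (x_ j * iter k (p i) f).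
  by rewrite fm mulr0 scaler0.
elim: k => [|k IH]; first by rewrite scale1r.
by rewrite iterS IH linearZ /= sklowerXM (negbTE ji) exprS -scalerA scaleN1r scalerN.
Qed.

Lemma sklowerX2M i j f : j != i -> p i (x_ j ^+ 2 * f) = x_ j ^+ 2 * p i f.
Proof.
move=> ji; rewrite expr2 -mulrA !sklowerXM (negbTE ji) mulrN opprK.
by rewrite mulrA.
Qed.

Lemma sklowerX2id i f : p i (x_ i ^+ 2 * f) = x_ i ^+ 2 * p i f + (x_ i *+ 2) * f.
Proof.
by rewrite expr2 -!mulrA !sklowerXM eqxx mulrDr addrA addrC mulr2n mulrDl.
Qed.

(** * The degree operator and the symmetries *)

(** On homogeneous elements this is multiplication by the degree, which is why
it is a derivation ([skdegM]). *)
Definition skdeg (f : P) : P := \sum_(i < n) x_ i * p i f.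

Lemma skdeg_is_linear : linear skdeg.
Proof.
move=> c f g; rewrite /skdeg scaler_sumr -big_split; apply: eq_bigr => i _ /=.
by rewrite linearP mulrDr -scalerAr.
Qed.
HB.instance Definition _ := GRing.isLinear.Build F P P *:%R skdeg skdeg_is_linear.

Lemma skdeg1 : skdeg 1 = 0.
Proof. by rewrite /skdeg big1 // => i _; rewrite sklower1 mulr0. Qed.

(** Moving [x_j] to the left of [x_i p_i] produces two signs, one from [p_i] and
one from [x_i], which cancel. *)
Lemma skdegXM j f : skdeg (x_ j * f) = x_ j * f + x_ j * skdeg f.
Proof.
rewrite /skdeg (bigD1 j) //= [X in _ = _ + _ * X](bigD1 j) //= sklowerXM eqxx.
rewrite !mulrDr -addrA; congr (_ + (_ + _)); rewrite mulr_sumr.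
apply: eq_bigr => i ij; rewrite sklowerXM eq_sym (negbTE ij).
by rewrite mulrN !mulrA (skX_anticomm _ ij) mulNr opprK.
Qed.

Lemma skdegX j : skdeg (x_ j) = x_ j.
Proof. by rewrite -[x_ j]mulr1 skdegXM skdeg1 mulr0 addr0. Qed.

(** The Leibniz rule carries no sign, contrary to the one of each [p_i]. *)
Lemma skdegM f g : skdeg (f * g) = skdeg f * g + f * skdeg g.
Proof.
elim/skew_ind: f => [|c f f' Hf Hf'|j f Hf].
- by rewrite skdeg1 mul0r !mul1r add0r.
- rewrite mulrDl -scalerAl. rewrite !linearP /= Hf Hf' !mulrDl -!scalerAl scalerDr.
  by rewrite addrACA.
by rewrite -mulrA !skdegXM Hf !mulrDl mulrDr -!mulrA addrA.
Qed.

Lemma skdeg_parity f : skdeg (\eps f) = \eps (skdeg f).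
Proof.
elim/skew_ind: f => [|c f g Hf Hg|j f Hf].
- by rewrite skparity1 skdeg1 linear0.
- by rewrite !linearP /= Hf Hg.
by rewrite skdegXM linearD /= !skparityM skparityX skdegM linearN /= skdegX Hf.
Qed.

Lemma skdeg_swap a b f : skdeg (s a b f) = s a b (skdeg f).
Proof.
elim/skew_ind: f => [|c f g Hf Hg|j f Hf].
- by rewrite skswap1 skdeg1 linear0.
- by rewrite !linearP /= Hf Hg.
by rewrite skdegXM linearD /= !skswapM skswapX skdegXM Hf.
Qed.

Lemma skdeg_lower i f : skdeg (p i f) = p i (skdeg f) - p i f.
Proof.
elim/skew_ind: f => [|c f g Hf Hg|j f Hf].
- by rewrite skdeg1 sklower1 !linear0 addr0.
- by rewrite !linearP /= Hf Hg scalerDr addrACA.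
rewrite skdegXM linearD [RHS]addrAC subrr add0r !sklowerXM.
case: eqP => _; first by rewrite linearD /= skdegXM Hf mulrBr [_ - _]addrC addNKr.
by rewrite linearN /= skdegXM Hf mulrBr [_ - _]addrC addNKr.
Qed.

Lemma skswap_lower a b i f : s a b (p i f) = p (tperm a b i) (s a b f).
Proof.
elim/skew_ind: f => [|c f g Hf Hg|j f Hf].
- by rewrite skswap1 !sklower1 linear0.
- by rewrite !linearP /= Hf Hg.
rewrite skswapM skswapX !sklowerXM (inj_eq perm_inj).
case: eqP => _; first by rewrite linearD /= skswapM skswapX Hf.
by rewrite linearN /= skswapM skswapX Hf.
Qed.

Lemma skswap_parity a b f : s a b (\eps f) = \eps (s a b f).
Proof.
elim/skew_ind: f => [|c f g Hf Hg|j f Hf].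
- by rewrite skparity1 skswap1 skparity1.
- by rewrite !linearP /= Hf Hg.
by rewrite skparityM !skswapM skparityM skparityX linearN /= skswapX skparityX Hf.
Qed.

Lemma skswap_conj a b i k f :
  s a b (s i k f) = s (tperm a b i) (tperm a b k) (s a b f).
Proof.
elim/skew_ind: f => [|c f g Hf Hg|j f Hf].
- by rewrite !skswap1.
- by rewrite !linearP /= Hf Hg.
rewrite !skswapM !skswapX Hf; congr (x_ _ * _).
by rewrite -(tpermJ i k (tperm a b)) permJ.
Qed.

(** * Uniqueness of the divided differences *)

Hypothesis char0 : [pchar F] =i pred0.

Lemma skX_reg i f : x_ i * f = 0 -> f = 0.
Proof.
apply: (mul_inj_of_commutator (p := p i) (c := 1) char0).
- by move=> v; rewrite sklowerXM eqxx addrC mul1r.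
- by rewrite mul1r mulr1.
- by move=> v; rewrite mul1r.
exact: sklower_nilp.
Qed.

(** [p_i] commutes with [x_k^2] and satisfies [p_i x_i^2 = x_i^2 p_i + 2 x_i]. *)
Lemma skXsqB_reg i k f : i != k -> (x_ k ^+ 2 - x_ i ^+ 2) * f = 0 -> f = 0.
Proof.
move=> ik.
apply: (mul_inj_of_commutator (p := p i) (c := - (x_ i *+ 2)) char0).
- move=> v; rewrite !mulrBl linearB /= sklowerX2M 1?eq_sym //.
  by rewrite sklowerX2id opprD addrA mulNr.
- have C j : x_ j ^+ 2 * (x_ i *+ 2) = (x_ i *+ 2) * x_ j ^+ 2 by rewrite skXsq_central.
  by rewrite mulNr mulrN mulrBl mulrBr !C.
- have two0 : (2%:R == 0 :> F) = false by move/pcharf0P: char0 => ->.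
  move=> v /eqP; rewrite mulNr oppr_eq0 -scaler_nat -scalerAl scaler_eq0 two0 /=.
  by move/eqP; apply: skX_reg.
exact: sklower_nilp.
Qed.

Definition skdivnum i k f : P :=
  (x_ k - x_ i) * f - s i k (\eps f) * (x_ k - x_ i).

Lemma skdivdiffP i k f : (x_ k ^+ 2 - x_ i ^+ 2) * skdivdiff i k f = skdivnum i k f.
Proof. exact: (svalP (cid (skdivdiff_exists i k f))). Qed.

(* These are values of choice principles or lifts from the free algebra; all
   that matters about them from here on is in the lemmas above. *)
Local Opaque skdivdiff sklower skparity skswap.

Lemma skdivdiff_unique i k f g : i != k ->
  (x_ k ^+ 2 - x_ i ^+ 2) * g = skdivnum i k f -> skdivdiff i k f = g.
Proof.
move=> ik gE; apply/eqP; rewrite -subr_eq0; apply/eqP/(skXsqB_reg ik).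
by rewrite mulrBr skdivdiffP gE subrr.
Qed.

Lemma skdivdiff_linear i k : i != k -> linear (@skdivdiff F n i k).
Proof.
move=> ik c f g; apply: skdivdiff_unique => //.
rewrite mulrDr -scalerAr !skdivdiffP /skdivnum !linearP /=.
rewrite [X in _ = X - _]mulrDr [X in _ = _ - X]mulrDl.
by rewrite -scalerAr -scalerAl scalerBr opprD addrACA.
Qed.

(** Applying the swap to the defining equation of the left-hand side gives the
one of the right-hand side. *)
Lemma skswap_divdiff a b i k f : i != k ->
  s a b (skdivdiff i k f) = skdivdiff (tperm a b i) (tperm a b k) (s a b f).
Proof.
move=> ik; apply/esym/skdivdiff_unique; first by rewrite (inj_eq perm_inj).
rewrite /skdivnum -skswap_parity -skswap_conj -!(skswapX _ _ _ _) !expr2 -!skswapM.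
by rewrite -!linearB /= -!skswapM -!expr2 skdivdiffP linearB.
Qed.

(** The dividend raises the degree by one and the divisor has degree 2, so the
quotient lowers it by one: apply the derivation [skdeg] to the defining
equation. *)
Lemma skdeg_divdiff i k f : i != k ->
  skdeg (skdivdiff i k f) = skdivdiff i k (skdeg f) - skdivdiff i k f.
Proof.
move=> ik; apply/eqP; rewrite eq_sym subr_eq; apply/eqP/skdivdiff_unique => //.
have := congr1 skdeg (skdivdiffP i k f).
have degZ : skdeg (x_ k ^+ 2 - x_ i ^+ 2) = (x_ k ^+ 2 - x_ i ^+ 2) *+ 2.
  by rewrite linearB /= !expr2 !skdegXM !skdegX mulrnBl -!mulr2n.
rewrite skdegM degZ mulrnAl skdivdiffP /skdivnum linearB /= !skdegM linearB /= !skdegX.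
rewrite skdeg_swap skdeg_parity => H; rewrite mulrDr skdivdiffP /skdivnum.
apply: (addIr ((x_ k - x_ i) * f - s i k (\eps f) * (x_ k - x_ i))).
by rewrite -addrA -mulr2n addrC H opprD [_ * f + _]addrC addrACA.
Qed.

Lemma skr_linear i k : k != i -> linear (@skr F n i k).
Proof. by rewrite eq_sym => ik c f g; rewrite /skr linearP /= (skdivdiff_linear ik). Qed.

Lemma skswap_r a b i k f : k != i ->
  s a b (skr i k f) = skr (tperm a b i) (tperm a b k) (s a b f).
Proof. by rewrite eq_sym => ik; rewrite /skr (skswap_divdiff _ _ _ ik) skswap_conj. Qed.

Lemma skdeg_r i k f : k != i -> skdeg (skr i k f) = skr i k (skdeg f) - skr i k f.
Proof. by rewrite eq_sym => ik; rewrite /skr (skdeg_divdiff _ ik) skdeg_swap. Qed.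

(** * Dunkl operators and the Euler operator *)

Section DunklOperators.
Context (t u : F).
Local Notation D := (@dunkl F n t u).

Lemma dunkl_linear i : linear (D i).
Proof.
move=> c f g; rewrite /dunkl linearP /=.
have H : \sum_(k < n | k != i) skr i k (c *: f + g) =
    c *: (\sum_(k < n | k != i) skr i k f) + \sum_(k < n | k != i) skr i k g.
  by rewrite scaler_sumr -big_split; apply: eq_bigr => k ki; exact: skr_linear.
rewrite [X in _ + u *: X = _]H.
by rewrite !scalerDr !scalerA [t * c]mulrC [u * c]mulrC addrACA.
Qed.

Lemma skswap_dunkl a b i f : s a b (D i f) = D (tperm a b i) (s a b f).
Proof.
rewrite /dunkl linearP linearZ /= [X in _ + u *: X = _]linear_sum skswap_lower /=.
congr (_ + _ *: _); rewrite [RHS](reindex_inj (@perm_inj _ (tperm a b))) /=.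
apply: eq_big => [k|k ki]; first by rewrite (inj_eq perm_inj).
exact: skswap_r.
Qed.

Lemma skdeg_dunkl i f : skdeg (D i f) = D i (skdeg f) - D i f.
Proof.
rewrite /dunkl linearP linearZ /= [X in _ + u *: X = _]linear_sum skdeg_lower /=.
have -> : \sum_(k < n | k != i) skdeg (skr i k f) =
    \sum_(k < n | k != i) skr i k (skdeg f) - \sum_(k < n | k != i) skr i k f.
  by rewrite -sumrB; apply: eq_bigr => k ki; exact: skdeg_r.
by rewrite !scalerBr opprD addrACA.
Qed.

Lemma laplace_linear : linear (@laplace F n t u).
Proof.
move=> c f g; rewrite /laplace.
have H : \sum_(i < n) D i (D i (c *: f + g)) =
    c *: (\sum_(i < n) D i (D i f)) + \sum_(i < n) D i (D i g).
  rewrite scaler_sumr -big_split; apply: eq_bigr => i _ /=.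
  exact: etrans (congr1 (D i) (dunkl_linear i c f g)) (dunkl_linear i c _ _).
rewrite [X in - (_ *: X) = _]H.
by rewrite scalerDr opprD scalerN !scalerA [_ * c]mulrC.
Qed.

(** The swap permutes the squares [D_i^2], hence preserves their sum. *)
Lemma skswap_laplace a b f : s a b (laplace t u f) = laplace t u (s a b f).
Proof.
rewrite /laplace linearN linearZ /= [X in - (_ *: X) = _]linear_sum /=.
rewrite [in RHS](reindex_inj (@perm_inj _ (tperm a b))) /=.
by congr (- (_ *: _)); apply: eq_bigr => i _; rewrite !skswap_dunkl.
Qed.

Lemma skdeg_laplace f :
  skdeg (laplace t u f) = laplace t u (skdeg f) + (- 2) *: laplace t u f.
Proof.
rewrite /laplace linearN linearZ /= [X in - (_ *: X) = _]linear_sum /=.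
have H i : skdeg (D i (D i f)) = D i (D i (skdeg f)) - 2 *: D i (D i f).
  have DB g h : D i (g - h) = D i g - D i h.
    by rewrite [g - h]addrC -scaleN1r (dunkl_linear i (-1) h g) scaleN1r addrC.
  rewrite [LHS]skdeg_dunkl (congr1 (D i) (skdeg_dunkl i f)) DB.
  by rewrite -addrA -opprD scaler_nat.
have {}H : \sum_(i < n) skdeg (D i (D i f)) =
    \sum_(i < n) D i (D i (skdeg f)) - 2 *: (\sum_(i < n) D i (D i f)).
  by rewrite scaler_sumr -sumrB; apply: eq_bigr => i _; exact: H.
rewrite [X in - (_ *: X) = _]H scalerBr opprB scaleNr scalerN opprK addrC.
by rewrite !scalerA [_^-1 * 2]mulrC.
Qed.

Lemma rsq_linear : linear (@rsq F n t).
Proof.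
move=> c f g; rewrite /rsq mulrDr -scalerAr scalerDr !scalerA.
by rewrite [_ * c]mulrC.
Qed.

Lemma skswap_rsq a b f : s a b (rsq t f) = rsq t (s a b f).
Proof.
rewrite /rsq linearZ /= skswapM linear_sum /=; congr (_ *: (_ * _)).
rewrite [RHS](reindex_inj (@perm_inj _ (tperm a b))) /=.
by apply: eq_bigr => i _; rewrite !expr2 skswapM !skswapX.
Qed.

Lemma skdeg_rsq f : skdeg (rsq t f) = rsq t (skdeg f) + 2 *: rsq t f.
Proof.
have deg_sq : skdeg (\sum_(i < n) x_ i ^+ 2) = 2 *: (\sum_(i < n) x_ i ^+ 2).
  rewrite linear_sum scaler_sumr; apply: eq_bigr => i _ /=.
  by rewrite expr2 skdegXM skdegX scaler_nat mulr2n.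
rewrite /rsq linearZ /= skdegM deg_sq addrC scalerDr -scalerAl.
by congr (_ + _); rewrite !scalerA mulrC.
Qed.

Definition skswapsum (f : P) : P := \sum_(i < n) \sum_(k < n | (i < k)%N) s i k f.

Lemma eulerE f :
  euler t u f = skdeg f + (n%:R / 2) *: f + (u / t) *: skswapsum f.
Proof. by []. Qed.

(** The scalar part of the Euler operator commutes with every linear map and the
sum of the swaps with every symmetric one, so only the degree operator
contributes to the commutator. *)
Lemma opcomm_euler (L : P -> P) (d : F) : linear L ->
    (forall a b f, s a b (L f) = L (s a b f)) ->
    (forall f, skdeg (L f) = L (skdeg f) + d *: L f) ->
  forall f, opcomm (euler t u) L f = d *: L f.
Proof.
move=> Llin Ls Ldeg f.
pose L' : {linear P -> P} := HB.pack L (GRing.isLinear.Build F P P *:%R L Llin).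
have LB (g h k : P) (b c : F) :
    L (g + b *: h + c *: k) = L g + b *: L h + c *: L k.
  change (L' (g + b *: h + c *: k) = L' g + b *: L' h + c *: L' k).
  by rewrite !linearD !linearZ.
have LS : L (skswapsum f) = skswapsum (L f).
  change (L' (skswapsum f) = skswapsum (L f)); rewrite linear_sum.
  apply: eq_bigr => i _; rewrite linear_sum; apply: eq_bigr => k _.
  exact/esym/Ls.
rewrite /opcomm !eulerE LB LS Ldeg; apply/eqP.
by rewrite subr_eq [_ + d *: _]addrC -!addrA.
Qed.

End DunklOperators.

End SkewOperators.

Theorem theorem4p10 (R : realType) (n : nat) (hn : (1 <= n)%N)
    (t u : R[i]) (ht : t != 0) (hu : u != 0) :
  (forall f : skewpoly R[i] n,
     opcomm (euler t u) (rsq t) f = 2 *: rsq t f) /\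
  (forall f : skewpoly R[i] n,
     opcomm (euler t u) (laplace t u) f = - 2 *: laplace t u f).
Proof.
split; apply: opcomm_euler.
- exact: rsq_linear.
- exact: skswap_rsq.
- exact: skdeg_rsq.
- exact: (laplace_linear (pchar_num _)).
- exact: (skswap_laplace (pchar_num _)).
exact: (skdeg_laplace (pchar_num _)).
Qed.
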